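(* Let $G=(V,E,w)$ be an undirected graph with $n$ vertices and nonnegative edge weights, let $\{p_e\}_{e\in E}\subseteq[0,1]$ be predictions, and let $C^*\subseteq E$ be a minimum cut of $G$ with respect to which $\eta,\rho$ are defined. Run the Boosted Karger's algorithm with parameters $B\ge1$ and integer threshold $t$ with $2\rho+2\le t\le n$. Then the probability that no edge of $C^*$ is contracted during the first phase is at least $$\left(\frac{t-2\rho-2}{n}\right)^{2\left(\eta+\frac{1-\eta}{B}\right)}.$$
   Context: $w(E')=\sum_{e\in E'}w(e)$; a minimum cut is a minimum-weight set of edges crossing a partition of $V$ into two nonempty parts. $\eta:=\sum_{e\in C^*}(1-p_e)w(e)/w(C^* )$, $\rho:=\sum_{e\in E\setminus C^*}p_ew(e)/w(C^* )$, with $\rho\ge1$ assumed. Contracting an edge merges its endpoints into a metavertex, removing self-loops and keeping parallel edges. Boosted Karger's algorithm: set $w_B(e)=(1+(B-1)(1-p_e))w(e)$. First phase: while more than $t$ vertices remain, pick a remaining edge $\bar e$ with probability $w_B(\bar e)/\sum_e w_B(e)$ (over remaining edges) and contract it. Second phase: with the original weights $w$, while at least 3 vertices remain, contract a remaining edge chosen with probability proportional to $w$; output the edges of $G$ between the final two metavertices. *)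

(* Defs.v *)
From HB Require Import structures.
From mathcomp Require Import all_boot all_order all_algebra.
From mathcomp Require Import reals exp.

Set Implicit Arguments.
Unset Strict Implicit.
Unset Printing Implicit Defensive.

Import Order.TTheory GRing.Theory Num.Theory.

Local Open Scope ring_scope.

(* A graph on the vertex type V has an abstract finite type E of edges, so
   parallel edges are allowed; simple graphs are the case where [ends] is
   injective. *)
Record graph (V E : finType) := Graph {
  ends : E -> {set V};
  card_ends : forall e, #|ends e| = 2 }.

Definition weight (R : realType) (E : finType) (w : E -> R) (F : {set E}) : R :=
  \sum_(e in F) w e.

Definition cut (V E : finType) (G : graph V E) (S : {set V}) : {set E} :=
  [set e | (ends G e :&: S != set0) && (ends G e :&: ~: S != set0)].

(* The two parts of the partition are S and ~: S. *)
Definition min_cut (R : realType) (V E : finType) (G : graph V E) (w : E -> R)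
    (C : {set E}) : Prop :=
  (exists S : {set V}, [/\ S != set0, ~: S != set0 & C = cut G S]) /\
  (forall S : {set V}, S != set0 -> ~: S != set0 ->
     weight w C <= weight w (cut G S)).

(* Both quotients are 0 when [weight w C] is 0, so [1 <= pred_rho w p C] forces
   [weight w C] to be positive for nonnegative w. *)
Definition pred_eta (R : realType) (E : finType) (w p : E -> R) (C : {set E}) : R :=
  (\sum_(e in C) (1 - p e) * w e) / weight w C.

Definition pred_rho (R : realType) (E : finType) (w p : E -> R) (C : {set E}) : R :=
  (\sum_(e in ~: C) p e * w e) / weight w C.

Definition boosted (R : realType) (E : finType) (B : R) (w p : E -> R) (e : E) : R :=
  (1 + (B - 1) * (1 - p e)) * w e.

(* A contracted graph is represented by the partition P of V whose blocks are
   its metavertices. *)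
Definition discrete_partition (V : finType) : {set {set V}} :=
  [set [set x] | x : V].

Definition meta_ends (V E : finType) (G : graph V E) (P : {set {set V}}) (e : E) :
    {set {set V}} :=
  pblock P @: ends G e.

(* Self-loops, i.e. edges with both endpoints in one block, are dropped. *)
Definition remaining (V E : finType) (G : graph V E) (P : {set {set V}}) : {set E} :=
  [set e | #|meta_ends G P e| == 2].

Definition contract (V E : finType) (G : graph V E) (P : {set {set V}}) (e : E) :
    {set {set V}} :=
  cover (meta_ends G P e) |: (P :\: meta_ends G P e).

(* Probability that, started from P and run until at most t metavertices are
   left, the random contraction with selection weights u contracts exactly the
   edges of s, in this order.  If the remaining edges have total weight 0 while
   more than t metavertices are left, the process is stuck and its mass is lost;
   this cannot happen when every cut has positive u-weight and t >= 1. *)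
Fixpoint run_prob (R : realType) (V E : finType) (G : graph V E) (u : E -> R)
    (t : nat) (P : {set {set V}}) (s : seq E) : R :=
  match s with
  | [::] => if (#|P| <= t)%N then 1 else 0
  | e :: s' =>
      if (t < #|P|)%N && (e \in remaining G P)
      then u e / weight u (remaining G P) * run_prob G u t (contract G P e) s'
      else 0
  end.

(* Each contraction removes one metavertex, so no run contracts more than #|V|
   edges, and the runs range over the sequences of length at most #|V|. *)
Definition first_phase_prob (R : realType) (V E : finType) (G : graph V E)
    (w p : E -> R) (B : R) (t : nat) (A : pred (seq E)) : R :=
  \sum_(s : #|V|.-bseq E | A s)
    run_prob G (boosted B w p) t (discrete_partition V) s.

(* Main.v *)
(* Let c = w(C), beta = eta + (1 - eta) / B, and suppose that m metavertices are
   left and no edge of C has been contracted.  Every metavertex has degree at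
   least c, so the remaining edges weigh at least m c / 2.  Boosting gives C the
   weight B beta c and gives the other remaining edges at least B c x / 2, where
   x = m - 2 - 2 rho.  Hence C survives the next step with probability at least
   x / (x + 2 beta) >= ((x - 1) / x)^(2 beta), and the product of these bounds
   over m = t + 1, ..., n telescopes. *)
Require Import Defs.
From HB Require Import structures.
From mathcomp Require Import all_boot all_order all_algebra.
From mathcomp Require Import reals exp ring lra.

Set Implicit Arguments.
Unset Strict Implicit.
Unset Printing Implicit Defensive.

Import Order.TTheory GRing.Theory Num.Theory.

Local Open Scope ring_scope.

(** * Sums over sequences of bounded length *)

Lemma big_bseqS (R : Type) (idx : R) (op : Monoid.com_law idx) (T : finType)
    (k : nat) (F : seq T -> R) :
  \big[op/idx]_(s : k.+1.-bseq T) F s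
    = op (F [::]) (\big[op/idx]_(x : T) \big[op/idx]_(s : k.-bseq T) F (x :: s)).
Proof.
(* Both index families are compared as plain lists without repetition: a nonempty sequence is a head
   followed by a tail with length bound lowered by one. *)
pose bs j := [seq val s | s <- index_enum {: j.-bseq T}].
have mem_bs j s : (s \in bs j) = (size s <= j)%N.
  apply/mapP/idP => [[b _ ->]|hs]; first exact: size_bseq.
  by exists (Bseq hs); rewrite ?mem_index_enum.
have uniq_bs j : uniq (bs j) by rewrite map_inj_uniq ?index_enum_uniq//; exact: val_inj.
have perm_bs : perm_eq (bs k.+1)
    ([::] :: [seq x :: s | x <- index_enum T, s <- bs k]).
  apply: uniq_perm; first exact: uniq_bs.
    rewrite /= allpairs_uniq ?index_enum_uniq ?uniq_bs// ?andbT; last first.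
      by move=> [x s] [y r] _ _ /= [-> ->].
    by apply/allpairsP => -[[x s] []].
  move=> [|x s]; rewrite mem_bs inE //=; apply/idP/allpairsP.
    by move=> hs; exists (x, s); rewrite mem_index_enum mem_bs.
  by move=> [[y r] /= []] _; rewrite mem_bs => hr [_ ->].
have -> : \big[op/idx]_(s : k.+1.-bseq T) F s = \big[op/idx]_(s <- bs k.+1) F s.
  by rewrite big_map.
rewrite (perm_big _ perm_bs) /= big_cons big_allpairs_dep.
by congr (op _ _); apply: eq_bigr => x _; rewrite big_map.
Qed.

(** * Partitions as contracted graphs, and their metavertex degrees *)

Section Contraction.
Variables (V E : finType) (G : graph V E).
Implicit Types (P : {set {set V}}) (S X : {set V}) (e : E).

Lemma endsP e : exists a b, ends G e = [set a; b].
Proof.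
by have /eqP/cards2P[a [b [_ ->]]] := card_ends G e; exists a, b.
Qed.

Lemma meta_ends2 P e a b :
  ends G e = [set a; b] -> meta_ends G P e = [set pblock P a; pblock P b].
Proof. by move=> h; rewrite /meta_ends h imsetU1 imset_set1. Qed.

Lemma in_cut2 S e a b :
  ends G e = [set a; b] -> (e \in cut G S) = ((a \in S) != (b \in S)).
Proof.
move=> h; rewrite inE h !setIUl.
have si (x : V) (Z : {set V}) : [set x] :&: Z = if x \in Z then [set x] else set0.
  case: ifP => hx; first by apply/setIidPl; rewrite sub1set.
  by apply/eqP; rewrite setI_eq0 disjoints1 hx.
have s0 (x : V) : ([set x] == set0) = false by rewrite -cards_eq0 cards1.
by rewrite !si !inE; case: (a \in S); case: (b \in S) => /=;
  rewrite ?setU0 ?set0U ?s0 ?eqxx ?andbF.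
Qed.

Lemma in_remaining2 P e a b :
  ends G e = [set a; b] -> (e \in remaining G P) = (pblock P a != pblock P b).
Proof. by move=> h; rewrite inE (meta_ends2 _ h) cards2; case: (_ != _). Qed.

(** For a partition [P], this says that [S] is a union of blocks. It turns the history that no edge
    of the cut has been contracted into an invariant of the current partition. *)
Definition saturated S P :=
  forall X a b, X \in P -> a \in X -> b \in X -> (a \in S) = (b \in S).

Section Partition.
Variable P : {set {set V}}.
Hypothesis partP : partition P [set: V].

Let tP : trivIset P. Proof. by case/and3P: partP. Qed.
Let P0 : set0 \notin P. Proof. by case/and3P: partP. Qed.

Let cP : cover P = [set: V]. Proof. by apply/eqP; case/and3P: partP. Qed.

Lemma mem_pblockT a : a \in pblock P a.
Proof. by rewrite mem_pblock cP. Qed.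

Lemma pblock_memT a : pblock P a \in P.
Proof. by rewrite pblock_mem ?cP. Qed.

Lemma pblock_eqE X a : X \in P -> (pblock P a == X) = (a \in X).
Proof.
move=> XP; apply/eqP/idP => [<-|]; first exact: mem_pblockT.
exact: def_pblock.
Qed.

Lemma meta_ends_sub e : meta_ends G P e \subset P.
Proof. by apply/subsetP => X /imsetP[a _ ->]; exact: pblock_memT. Qed.

(** The edges at a metavertex form a cut of the original graph, so minimality of the cut bounds
    every metavertex degree from below. *)
Lemma in_cut_block X e : X \in P ->
  (e \in cut G X) = (e \in remaining G P) && (X \in meta_ends G P e).
Proof.
move=> XP; have [a [b h]] := endsP e.
rewrite (in_cut2 _ h) (in_remaining2 _ h) (meta_ends2 _ h) !inE.
rewrite -!(pblock_eqE _ XP) ![X == _]eq_sym.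
case: (pblock P a =P X) => [<-|na].
  by rewrite [pblock P b == _]eq_sym andbT; case: (_ == pblock P b).
case: (pblock P b =P X) => [eb|nb]; last by rewrite andbF.
by rewrite eb (introF eqP na).
Qed.

Lemma cover_disjoint_setD (Q : {set {set V}}) X :
  Q \subset P -> X \in P :\: Q -> [disjoint cover Q & X].
Proof.
move=> QP /setDP[XP XQ]; rewrite disjoint_sym; apply: bigcup_disjoint => Y YQ.
rewrite disjoint_sym; apply: (trivIsetP tP) => //; first exact: (subsetP QP).
by apply: contraNneq XQ => <-.
Qed.

(** Otherwise the merged block would be disjoint from itself, hence empty. This makes the block
    count drop by exactly one. *)
Lemma contract_merge_notin e : cover (meta_ends G P e) \notin P :\: meta_ends G P e.
Proof.
apply/negP => h; have := cover_disjoint_setD (meta_ends_sub e) h.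
rewrite -setI_eq0 setIid => /eqP h0.
by move: P0; rewrite -h0; case/setDP: h => ->.
Qed.

Lemma contract_partition e : partition (contract G P e) [set: V].
Proof.
set Q := meta_ends G P e; have QP : Q \subset P := meta_ends_sub e.
apply/and3P; split.
- rewrite /cover /contract bigcup_setU big_set1 -/Q -bigcup_setU.
  by rewrite setDE setUIr setUCr setIT (setUidPr QP) -/(cover P) cP.
- apply/trivIsetP => X Y; rewrite /contract -/Q => /setU1P[->|XP] /setU1P[->|YP].
  + by rewrite eqxx.
  + by move=> _; exact: cover_disjoint_setD.
  + by move=> _; rewrite disjoint_sym; exact: cover_disjoint_setD.
  + by apply: (trivIsetP tP); case/setDP: XP; case/setDP: YP.
- apply/negP => /setU1P[/esym h|]; last by case/setDP; rewrite (negPf P0).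
  have [a [b hab]] := endsP e.
  have : a \in cover Q; last by rewrite h inE.
  apply/bigcupP; exists (pblock P a); rewrite ?mem_pblockT //.
  by rewrite /Q (meta_ends2 _ hab) !inE eqxx.
Qed.

Lemma card_contract e : e \in remaining G P -> #|P| = #|contract G P e|.+1.
Proof.
rewrite inE => /eqP h2; rewrite /contract cardsU1 contract_merge_notin.
have := cardsID (meta_ends G P e) P.
by rewrite (setIidPr (meta_ends_sub e)) h2 => <-.
Qed.

Lemma cut_sub_remaining S : saturated S P -> cut G S \subset remaining G P.
Proof.
move=> hS; apply/subsetP => e; have [a [b h]] := endsP e.
rewrite (in_cut2 _ h) (in_remaining2 _ h); apply: contra_neq => hab.
by apply: (hS (pblock P a)); rewrite ?pblock_memT ?mem_pblockT // hab mem_pblockT.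
Qed.

Lemma saturated_contract S e :
  saturated S P -> e \notin cut G S -> saturated S (contract G P e).
Proof.
move=> hS; have [a [b h]] := endsP e; rewrite (in_cut2 _ h) negbK => /eqP hab.
move=> X x y /setU1P[->|/setDP[XP _]]; last exact: hS.
have memS z : z \in cover (meta_ends G P e) -> (z \in S) = (a \in S).
  case/bigcupP => Y; rewrite (meta_ends2 _ h) !inE => /orP[]/eqP-> hz.
    by apply: (hS (pblock P a)); rewrite ?pblock_memT ?mem_pblockT.
  by rewrite hab; apply: (hS (pblock P b)); rewrite ?pblock_memT ?mem_pblockT.
by move=> /memS -> /memS ->.
Qed.

End Partition.

Lemma discrete_partitionP : partition (discrete_partition V) [set: V].
Proof.
apply/and3P; split.
- by apply/eqP/setP => x; rewrite inE; apply/bigcupP; exists [set x]; rewrite ?inE // imset_f.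
- apply/trivIsetP => _ _ /imsetP[x _ ->] /imsetP[y _ ->] hxy.
  by rewrite disjoints1 inE; apply: contra_neqN hxy => /eqP->.
- by apply/imsetP => -[x _ /setP/(_ x)]; rewrite !inE eqxx.
Qed.

Lemma card_discrete_partition : #|discrete_partition V| = #|V|.
Proof. by rewrite card_imset //; exact: set1_inj. Qed.

Lemma saturated_discrete S : saturated S (discrete_partition V).
Proof. by move=> _ a b /imsetP[x _ ->] /set1P-> /set1P->. Qed.

Lemma card_min_cut_le (R : realType) (w : E -> R) (C : {set E}) P :
  min_cut G w C -> partition P [set: V] -> (1 < #|P|)%N ->
  #|P|%:R * weight w C <= 2 * weight w (remaining G P).
Proof.
move=> [_ hC] pP P2.
have [tP nP0] : trivIset P /\ set0 \notin P by case/and3P: pP.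
(* Handshake: a remaining edge is counted once at each of its two metavertices. *)
have -> : 2 * weight w (remaining G P) = \sum_(X in P) weight w (cut G X).
  rewrite /weight mulr_sumr (exchange_big_dep (mem (remaining G P))) /=; last first.
    by move=> X e XP; rewrite (in_cut_block pP) // => /andP[].
  apply: eq_bigr => e he; rewrite sumr_const mulr_natl; congr (_ *+ _).
  have := he; rewrite inE => /eqP h2; rewrite -[LHS]h2; apply: eq_card => X.
  rewrite [RHS]inE; apply/idP/andP => [hX|[XP]].
    have XP := subsetP (meta_ends_sub pP e) _ hX.
    by rewrite (in_cut_block pP) // he hX.
  by rewrite (in_cut_block pP) // => /andP[].
rewrite mulr_natl -sumr_const; apply: ler_sum => X XP; apply: hC.
  by apply: contraNneq nP0 => <-.
(* As there are at least two blocks, another block witnesses that the complement of [X] is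
   nonempty. *)
have /set0Pn[Y] : P :\ X != set0 by move: P2; rewrite (cardsD1 X) XP -card_gt0.
rewrite !inE => /andP[YX YP]; have /set0Pn[y yY] : Y != set0 by apply: contraNneq nP0 => <-.
apply/set0Pn; exists y; rewrite inE; apply/negP => yX.
by have /(_ YX)/disjointFr/(_ yY) := trivIsetP tP _ _ YP XP; rewrite yX.
Qed.

End Contraction.

(* From 1 - 1/x <= exp (- 1/x) and 1 + b/x <= exp (b/x). *)
Lemma powR_pred_ratio (R : realType) (x b : R) :
  1 <= x -> 0 <= b -> (x - 1) `^ b * (x + b) <= x `^ b * x.
Proof.
move=> x1 b0; have x0 : 0 < x by lra.
have h1 : x - 1 <= x * sequences.expR (- x^-1).
  have := ler_wpM2l (ltW x0) (expR_ge1Dx (- x^-1)).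
  by rewrite mulrDr mulr1 mulrN divff ?gt_eqF.
have h2 : x + b <= x * sequences.expR (x^-1 * b).
  have := ler_wpM2l (ltW x0) (expR_ge1Dx (x^-1 * b)).
  by rewrite mulrDr mulr1 mulrA divff ?gt_eqF // mul1r.
(* Raising [h1] to the power [b] needs [x - 1] nonnegative. The exponential factors of [h2] and [h3]
   then cancel. *)
have h3 : (x - 1) `^ b <= x `^ b * sequences.expR (- (x^-1 * b)).
  rewrite -mulNr expRM -powRM ?expR_ge0 ?(ltW x0) //.
  by apply: ge0_ler_powR; rewrite ?nnegrE ?mulr_ge0 ?expR_ge0 ?(ltW x0) //; lra.
apply: le_trans (ler_pM _ _ h3 h2) _; rewrite ?powR_ge0 //; first lra.
by rewrite mulrACA -expRD addNr expR0 mulr1.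
Qed.

(** * Probability that a cut survives random contraction *)

Section Avoidance.
Variables (R : realType) (V E : finType) (G : graph V E) (u : E -> R) (t : nat).
Hypothesis u_ge0 : forall e, 0 <= u e.

Lemma weight_ge0 (F : {set E}) : 0 <= weight u F.
Proof. exact: sumr_ge0. Qed.

Lemma run_prob_ge0 P s : 0 <= run_prob G u t P s.
Proof.
elim: s P => [|e s IH] P /=; first by case: ifP.
by case: ifP => // _; rewrite mulr_ge0 ?divr_ge0 ?weight_ge0.
Qed.

(** The start [P] and the length bound [k] are left free for the induction; [first_phase_prob] is
    the case of the discrete partition and [k = #|V|]. *)
Definition avoid_prob (C : {set E}) (k : nat) (P : {set {set V}}) : R :=
  \sum_(s : k.-bseq E | all (fun e => e \notin C) s) run_prob G u t P s.

Lemma avoid_prob_ge0 C k (P : {set {set V}}) : 0 <= avoid_prob C k P.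
Proof. by apply: sumr_ge0 => s _; exact: run_prob_ge0. Qed.

Lemma avoid_prob_stop C k (P : {set {set V}}) : (#|P| <= t)%N -> 1 <= avoid_prob C k P.
Proof.
move=> hP; rewrite /avoid_prob (bigD1 [bseq]) //= hP lerDl.
by apply: sumr_ge0 => s _; exact: run_prob_ge0.
Qed.

(** Conditioning on the first contracted edge. The empty run contributes nothing, since more than
    [t] metavertices remain. *)
Lemma avoid_probS C k (P : {set {set V}}) : (t < #|P|)%N ->
  avoid_prob C k.+1 P =
  \sum_(e in remaining G P :\: C)
     u e / weight u (remaining G P) * avoid_prob C k (contract G P e).
Proof.
move=> tP; rewrite /avoid_prob big_mkcond.
rewrite (big_bseqS _ _
  (fun s => if all (fun e => e \notin C) s then run_prob G u t P s else 0)).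
rewrite /= leqNgt tP add0r [RHS]big_mkcond; apply: eq_bigr => e _.
rewrite in_setD; case: (e \in C) => /=; first by rewrite big1.
case: (e \in remaining G P) => /=; last by rewrite big1 // => s _; case: ifP.
by rewrite -big_mkcond mulr_sumr.
Qed.

(* Multiplied out, with r = 2 rho + 2, so that nothing is divided by #|P| - r,
   which may be 0 when #|P| = t. *)
Lemma avoid_prob_lb (S : {set V}) (r b : R) :
  0 <= b -> r <= t%:R -> 0 < weight u (cut G S) ->
  (forall P : {set {set V}}, partition P [set: V] -> saturated S P -> (t < #|P|)%N ->
     (#|P|%:R - r) * weight u (cut G S)
       <= b * weight u (remaining G P :\: cut G S)) ->
  forall k (P : {set {set V}}), partition P [set: V] -> saturated S P ->
    (t <= #|P| <= t + k)%N ->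
    (t%:R - r) `^ b <= (#|P|%:R - r) `^ b * avoid_prob (cut G S) k P.
Proof.
move=> b0 rt uC step; set C := cut G S.
elim=> [|k IH] P pP sP /andP[tP Pk].
  have -> : #|P| = t by apply/eqP; rewrite eqn_leq tP -[X in (_ <= X)%N]addn0 Pk.
  by rewrite ler_peMr ?powR_ge0 // avoid_prob_stop // -[X in (_ <= X)%N]addn0.
have [Pt|{}tP] := leqP #|P| t.
  have -> : #|P| = t by apply/eqP; rewrite eqn_leq tP Pt.
  by rewrite ler_peMr ?powR_ge0 // avoid_prob_stop.
set x : R := #|P|%:R - r; set y : R := t%:R - r.
set W := weight u (remaining G P); set D := weight u (remaining G P :\: C).
(* Here [#|P|] is at least [t + 1] and [r <= t], which gives the range required by
   [powR_pred_ratio]. *)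
have x1 : 1 <= x by rewrite /x; move: tP; rewrite -(ler_nat R) -natr1; lra.
have WE : W = weight u C + D.
  rewrite /W /D /weight (big_setID C) /= (setIidPr _) //.
  exact: cut_sub_remaining.
have D0 : 0 <= D := weight_ge0 _.
have W0 : 0 < W by rewrite WE ltr_wpDr.
(* Adding [x * D] to both sides of [step] bounds the one-step survival probability [D / W] from
   below by [x / (x + b)]. *)
have hstep : x * W <= (x + b) * D.
  by have := step P pP sP tP; rewrite WE -/C -/x -/D; lra.
(* The induction hypothesis after each admissible contraction, where [x] has become [x - 1], summed
   with weights [u e]. *)
have hsum : y `^ b * D <= (x - 1) `^ b * (W * avoid_prob C k.+1 P).
  rewrite avoid_probS // /D /weight !mulr_sumr; apply: ler_sum => e.
  rewrite in_setD => /andP[eC eR].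
  have cE := card_contract pP eR.
  have xE : x - 1 = #|contract G P e|%:R - r by rewrite /x cE -natr1; lra.
  have -> (q : R) : W * (u e / W * q) = u e * q by field; rewrite gt_eqF.
  rewrite mulrC mulrCA ler_wpM2l // xE; apply: IH.
  - exact: contract_partition.
  - exact: saturated_contract.
  - by rewrite -ltnS -cE tP -ltnS -cE -addnS.
have x0 : 0 < x by lra.
(* With [A] the survival probability, the chain is [y^b x W <= y^b (x + b) D <= (x - 1)^b (x + b) W
   A <= x^b x W A]. *)
rewrite -(ler_pM2r x0) -(ler_pM2r W0) -mulrA.
apply: le_trans (ler_wpM2l (powR_ge0 _ _) hstep) _.
have := powR_pred_ratio x1 b0; set q := (x - 1) `^ b in hsum *; move=> hq.
have WA : 0 <= W * avoid_prob C k.+1 P by rewrite mulr_ge0 ?avoid_prob_ge0 // ltW.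
have xb : 0 <= x + b by lra.
have := ler_wpM2l xb hsum; have := ler_wpM2l WA hq.
lra.
Qed.

End Avoidance.

(** * Effect of boosting on the cut and on the other edges *)

Section Boosted.
Variables (R : realType) (V E : finType) (G : graph V E) (w p : E -> R).
Variables (C : {set E}) (B : R).
Hypotheses (w_ge0 : forall e, 0 <= w e) (p_01 : forall e, 0 <= p e <= 1).
Hypotheses (minC : min_cut G w C) (C_gt0 : 0 < weight w C) (B1 : 1 <= B).

Let rho := pred_rho w p C.
Let eta := pred_eta w p C.

Lemma boosted_ge0 e : 0 <= boosted B w p e.
Proof.
have := p_01 e; rewrite /boosted => /andP[p0 p1].
by rewrite mulr_ge0 // addr_ge0 // mulr_ge0 // subr_ge0.
Qed.

Lemma pred_eta_ge0 : 0 <= eta.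
Proof.
apply: divr_ge0; last exact: ltW.
apply: sumr_ge0 => e _.
by have /andP[_ p1] := p_01 e; rewrite mulr_ge0 // subr_ge0.
Qed.

(** Boosting adds [(B - 1) * eta * w(C)] to the cut, and [1 + (B - 1) * eta] equals
    [B * (eta + (1 - eta) / B)]. *)
Lemma weight_boosted_cut :
  weight (boosted B w p) C = B * (eta + (1 - eta) / B) * weight w C.
Proof.
have -> : weight (boosted B w p) C = weight w C + (B - 1) * (eta * weight w C).
  rewrite /eta /pred_eta divfK ?gt_eqF // mulr_sumr -big_split /=.
  by apply: eq_bigr => e _; rewrite /boosted; ring.
by field; rewrite gt_eqF // (lt_le_trans ltr01).
Qed.

Lemma weight_boosted_remaining P :
  partition P [set: V] -> (1 < #|P|)%N -> C \subset remaining G P ->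
  B * ((#|P|%:R - 2 - 2 * rho) / 2 * weight w C)
    <= weight (boosted B w p) (remaining G P :\: C).
Proof.
move=> pP P2 CP; have := card_min_cut_le minC pP P2.
set D := remaining G P :\: C.
have -> : weight w (remaining G P) = weight w C + weight w D.
  by rewrite /weight (big_setID C) /= (setIidPr CP).
have -> : weight (boosted B w p) D = B * weight w D - (B - 1) * \sum_(e in D) p e * w e.
  rewrite /weight !mulr_sumr -sumrB.
  by apply: eq_bigr => e _; rewrite /boosted; ring.
(* [D] avoids [C], so this sum is part of the numerator of [rho]. *)
have hD : \sum_(e in D) p e * w e <= rho * weight w C.
  rewrite /rho /pred_rho divfK ?gt_eqF // [leRHS](big_setID D) /=.
  have -> : ~: C :&: D = D by apply/setIidPr; rewrite /D setDE subsetIr.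
  rewrite lerDl; apply: sumr_ge0 => e _.
  by have /andP[p0 _] := p_01 e; rewrite mulr_ge0.
(* This is the slack in the final estimate: [B - 1] copies of [rho * w(C)] are lost, while the bound
   allows for [B]. *)
have rho0 : 0 <= rho * weight w C.
  apply: le_trans hD; apply: sumr_ge0 => e _.
  by have /andP[p0 _] := p_01 e; rewrite mulr_ge0.
move=> hm; have hB : 0 <= B - 1 by rewrite subr_ge0.
have hB0 : 0 <= B by rewrite (le_trans ler01).
have h1 := ler_wpM2l hB hD; have h2 := ler_wpM2l hB0 hm.
nra.
Qed.

End Boosted.

Theorem theorem5 (R : realType) (V E : finType) (G : graph V E) (w p : E -> R)
    (C : {set E}) (B : R) (t : nat)
    (hw : forall e, 0 <= w e)
    (hp : forall e, 0 <= p e <= 1)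
    (hC : min_cut G w C)
    (hrho : 1 <= pred_rho w p C)
    (hB : 1 <= B)
    (ht : 2 * pred_rho w p C + 2 <= t%:R)
    (htn : (t <= #|V|)%N) :
  ((t%:R - 2 * pred_rho w p C - 2) / #|V|%:R)
      `^ (2 * (pred_eta w p C + (1 - pred_eta w p C) / B))
    <= first_phase_prob G w p B t (fun s => all (fun e => e \notin C) s).
Proof.
have C_gt0 : 0 < weight w C.
  rewrite lt_neqAle weight_ge0 // andbT; apply: contraTneq hrho => hC0.
  by rewrite /pred_rho -hC0 invr0 mulr0 -ltNge ltr01.
have B0 : 0 < B by lra.
have beta0 : 0 < pred_eta w p C + (1 - pred_eta w p C) / B.
  have eta0 : 0 <= pred_eta w p C by exact: pred_eta_ge0.
  (* In this form positivity follows from [eta >= 0] and [B >= 1] alone. *)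
  have -> : pred_eta w p C + (1 - pred_eta w p C) / B
            = (pred_eta w p C * (B - 1) + 1) / B by field; rewrite gt_eqF.
  by rewrite divr_gt0 // ltr_wpDl // mulr_ge0 // subr_ge0.
set beta := pred_eta w p C + _ in beta0 *; set rho := pred_rho w p C in hrho ht *.
have [[S [S0 CS0 CE]] _] := hC.
have u0 := boosted_ge0 hw hp hB.
have uC := weight_boosted_cut p C_gt0 hB; rewrite -/beta in uC.
have n0 : 0 < #|V|%:R :> R.
  by apply: lt_le_trans (_ : t%:R <= _); rewrite ?ler_nat //; lra.
have lb : (t%:R - (2 * rho + 2)) `^ (2 * beta)
    <= (#|V|%:R - (2 * rho + 2)) `^ (2 * beta)
         * avoid_prob G (boosted B w p) t C #|V| (discrete_partition V).
  have := @avoid_prob_lb R V E G (boosted B w p) t u0 S (2 * rho + 2) (2 * beta).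
  rewrite -CE; move=> /(_ _ ht _ _ #|V| (discrete_partition V)).
  rewrite card_discrete_partition; apply.
  - by rewrite mulr_ge0 // ltW.
  - by rewrite uC !mulr_gt0.
  - move=> P pP sP tP; have CP : C \subset remaining G P.
      by rewrite CE; exact: cut_sub_remaining.
    (* From [rho >= 1] the threshold [t] is at least 4. *)
    have P1 : (1 < #|P|)%N.
      by rewrite -(ltr_nat R); move: tP; rewrite -(ltr_nat R); lra.
    have := weight_boosted_remaining hw hp hC C_gt0 hB pP P1 CP.
    rewrite -/rho uC => h.
    have b2 : 0 <= 2 * beta by rewrite mulr_ge0 // ltW.
    have := ler_wpM2l b2 h; lra.
  - exact: discrete_partitionP.
  - exact: saturated_discrete.
  - by rewrite htn leq_addl.
rewrite /first_phase_prob -/(avoid_prob _ _ _ _ _ _).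
have y0 : 0 <= t%:R - 2 * rho - 2 by lra.
have b2 : 0 <= 2 * beta by rewrite mulr_ge0 // ltW.
have nb : 0 < #|V|%:R `^ (2 * beta) by rewrite powR_gt0.
rewrite -(ler_pM2l nb) -powRM ?divr_ge0 ?(ltW n0) //.
rewrite mulrC divfK ?gt_eqF //.
have -> : t%:R - 2 * rho - 2 = t%:R - (2 * rho + 2) by ring.
(* Telescoping leaves the base [n - 2 rho - 2], with [n = #|V|]; enlarging it to [n] gives the
   stated denominator. *)
apply: le_trans lb _; rewrite ler_wpM2r ?avoid_prob_ge0 //.
have tn : t%:R <= #|V|%:R :> R by rewrite ler_nat.
by apply: ge0_ler_powR; rewrite ?nnegrE //; lra.
Qed.
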